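(* Let $u$ and $v$ be nonadjacent (distinct) vertices of a graph $G$. Then $\gamma(G) \leq \gamma(G_{u,v,3}) \leq \gamma(G)+1$. Moreover, $\gamma(G_{u,v,3}) = \gamma(G)$ if and only if at least one of the following holds: (i) $u \in V^-(G)$ and $v$ is a $\gamma$-good vertex of $G-u$; (ii) $v \in V^-(G)$ and $u$ is a $\gamma$-good vertex of $G-v$.
   Context: Graphs are finite and simple. $\gamma(H)$ denotes the domination number of a graph $H$; a $\gamma$-set of $H$ is a dominating set of $H$ of cardinality $\gamma(H)$. A vertex of $H$ is a $\gamma$-good vertex of $H$ if it belongs to some $\gamma$-set of $H$. $V^-(H) = \{x \in V(H) \mid \gamma(H-x) < \gamma(H)\}$. For distinct vertices $u,v$ of $G$, $G_{u,v,3}$ is the graph obtained from $G$ by adding three new vertices $x_1,x_2,x_3$ and the edges $ux_1$, $x_1x_2$, $x_2x_3$, $x_3v$. *)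

(* Defs.v *)
From mathcomp Require Import all_boot.

Set Implicit Arguments.
Unset Strict Implicit.
Unset Printing Implicit Defensive.

Record sgraph := SGraph {
  vertex :> finType;
  adj : rel vertex;
  adj_sym : symmetric adj;
  adj_irrefl : irreflexive adj }.

Section Domination.
Variable H : sgraph.
Implicit Types (x : H) (D : {set H}).

Definition dominating D : bool :=
  [forall x, (x \in D) || [exists y in D, adj x y]].

(* The default value [set: H] is always dominating, so this is a true minimum,
   also for the graph without vertices (where it is 0). *)
Definition gamma : nat :=
  #|[arg min_(D < [set: H] | dominating D) #|D|]|.

Definition gamma_set D : bool := dominating D && (#|D| == gamma).

Definition gamma_good x : bool := [exists D, gamma_set D && (x \in D)].

End Domination.

Section VertexDeletion.
Variables (H : sgraph) (x : H).

Definition del_vertex_type : finType := {y : H | y != x}.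

Definition del_adj : rel del_vertex_type := fun y z => adj (val y) (val z).

Lemma del_adj_sym : symmetric del_adj.
Proof. by move=> y z; apply: adj_sym. Qed.

Lemma del_adj_irrefl : irreflexive del_adj.
Proof. by move=> y; apply: adj_irrefl. Qed.

Definition del_vertex : sgraph := SGraph del_adj_sym del_adj_irrefl.

Definition in_del (y : H) (yNx : y != x) : del_vertex :=
  exist (fun z => z != x) y yNx.

End VertexDeletion.

Definition Vminus (H : sgraph) : {set H} :=
  [set x | gamma (del_vertex x) < gamma H].

Section PathAddition.
Variables (G : sgraph) (u v : G).

(* inr 0, inr 1, inr 2 are the new vertices x_1, x_2, x_3. *)
Definition path3_type : finType := (G + 'I_3)%type.

(* The new edges u x_1, x_1 x_2, x_2 x_3, x_3 v are listed in one direction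
   only; path3_adj symmetrises. *)
Definition path3_arc (a b : path3_type) : bool :=
  match a, b with
  | inl y, inl z => adj y z
  | inl y, inr i => (y == u) && (i == 0 :> nat)
  | inr i, inr j => j == i.+1 :> nat
  | inr i, inl z => (i == 2 :> nat) && (z == v)
  end.

Definition path3_adj : rel path3_type :=
  fun a b => path3_arc a b || path3_arc b a.

Lemma path3_adj_sym : symmetric path3_adj.
Proof. by move=> a b; rewrite /path3_adj orbC. Qed.

Lemma path3_adj_irrefl : irreflexive path3_adj.
Proof.
by move=> [y|i]; rewrite /path3_adj orbb /= ?adj_irrefl // ltn_eqF.
Qed.

Definition path3 : sgraph := SGraph path3_adj_sym path3_adj_irrefl.

End PathAddition.

Lemma neq_sym (T : eqType) (x y : T) : x != y -> y != x.
Proof. by rewrite eq_sym. Qed.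

(* Main.v *)
Require Import Defs.
From mathcomp Require Import all_boot.

(** A dominating set of [path3 u v] is a set [D] of old vertices together with
    a choice of new ones, where [D] may fail to dominate [u] only if [x_1] is
    chosen and [v] only if [x_3] is chosen.  Replacing [x_1] by [u] and [x_3] by
    [v] gives [gamma G <= gamma (path3 u v)], strictly if [x_2] is chosen.
    Hence in the case of equality [x_1] or [x_3] is chosen but not [x_2]; if
    [x_1] is, then replacing only [x_3] by [v] gives a set containing [v], with
    fewer than [gamma G] elements, that dominates every vertex other than [u].
    Such sets exist exactly when (i) holds. *)

Set Implicit Arguments.
Unset Strict Implicit.
Unset Printing Implicit Defensive.

(** * Domination, and domination of all vertices but one *)

Section DominationTheory.
Variable H : sgraph.
Implicit Types (x y : H) (D E : {set H}).

Definition dominated D x : bool := (x \in D) || [exists y in D, adj x y].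

Lemma dominatingP D : reflect (forall x, dominated D x) (dominating D).
Proof. exact: forallP. Qed.

Lemma dominatedS D E x : D \subset E -> dominated D x -> dominated E x.
Proof.
move/subsetP=> sDE /orP[/sDE xE | /exists_inP[y /sDE yE xy]].
  by rewrite /dominated xE.
by apply/orP; right; apply/exists_inP; exists y.
Qed.

Lemma dominated_in D x : x \in D -> dominated D x.
Proof. by rewrite /dominated => ->. Qed.

Lemma dominatingT : dominating [set: H].
Proof. by apply/dominatingP => x; rewrite dominated_in ?inE. Qed.

Lemma gamma_le D : dominating D -> gamma H <= #|D|.
Proof.
by rewrite /gamma; case: arg_minnP => [|A _ minA];
  [exact: dominatingT | exact: minA].
Qed.

Lemma gamma_setP : exists2 D : {set H}, dominating D & #|D| = gamma H.
Proof.
rewrite /gamma; case: arg_minnP => [|A domA _]; first exact: dominatingT.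
by exists A.
Qed.

(** Expresses domination of the graph without [x] by sets of vertices of [H], avoiding the subtype;
    [D] may still contain or dominate [x]. *)
Definition dominates_except x D := forall y, y != x -> dominated D y.

Lemma dominating_except x D :
  dominates_except x D -> x \in D -> dominating D.
Proof.
move=> domD xD; apply/dominatingP => y.
by have [-> | /domD //] := eqVneq y x; apply: dominated_in.
Qed.

End DominationTheory.

(** * Vertex deletion and condition (i) *)

Section Deletion.
Variables (H : sgraph) (u : H).

Lemma dominates_except_imset (D : {set del_vertex u}) :
  dominating D -> dominates_except u (val @: D).
Proof.
move=> /dominatingP domD y yNu; have /orP[yD | /exists_inP[z zD yz]] := domD (in_del yNu).
  by apply: dominated_in; apply/imsetP; exists (in_del yNu).
apply/orP; right; apply/exists_inP; exists (val z) => //.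
exact: imset_f.
Qed.

Lemma dominating_preimset (E : {set H}) : u \notin E ->
  dominates_except u E -> dominating (val @^-1: E : {set del_vertex u}).
Proof.
move=> uE domE; apply/dominatingP => y.
have /orP[yE | /exists_inP[z zE yz]] := domE _ (valP y).
  by apply: dominated_in; rewrite inE.
have zNu : z != u by apply: contraNneq uE => <-.
by apply/orP; right; apply/exists_inP; exists (in_del zNu); rewrite ?inE.
Qed.

(** Adding [u] to a minimum dominating set of [del_vertex u] dominates [H]. *)
Lemma gamma_le_del : gamma H <= (gamma (del_vertex u)).+1.
Proof.
have [D domD <-] := gamma_setP (del_vertex u).
apply: leq_trans (_ : #|u |: val @: D| <= _).
  apply/gamma_le/(dominating_except (x := u)); last exact: setU11.
  move=> y /(dominates_except_imset domD); apply: dominatedS; exact: subsetUr.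
by rewrite cardsU1 (card_imset _ val_inj); case: (_ \notin _).
Qed.

(** A set [E] as on the right cannot contain [u], since it would then dominate [H] with too few
    vertices. So it lives in [del_vertex u], and it is minimum there because deleting [u] lowers
    [gamma] by at most one. *)
Lemma Vminus_goodP v (vNu : v != u) :
  u \in Vminus H /\ gamma_good (in_del vNu) <->
  exists E : {set H}, [/\ v \in E, #|E| < gamma H & dominates_except u E].
Proof.
rewrite inE; split=> [[ltg /existsP[D /andP[/andP[domD /eqP cardD] vD]]] | [E [vE ltE domE]]].
  exists (val @: D); split; last exact: dominates_except_imset.
    by apply/imsetP; exists (in_del vNu).
  by rewrite (card_imset _ val_inj) cardD.
have uE : u \notin E.
  by apply/negP => /(dominating_except domE)/gamma_le; rewrite leqNgt ltE.
have domD := dominating_preimset uE domE.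
set D : {set del_vertex u} := val @^-1: E in domD.
have leD : #|D| <= #|E|.
  rewrite -(card_imset _ val_inj); apply: subset_leq_card.
  by apply/subsetP => _ /imsetP[z zD ->]; rewrite inE in zD.
split; first exact: leq_ltn_trans (gamma_le domD) (leq_ltn_trans leD ltE).
apply/existsP; exists D; rewrite [_ \in D]inE vE andbT
  /gamma_set domD /= eqn_leq gamma_le // andbT.
by rewrite (leq_trans leD) // -ltnS (leq_trans ltE) // gamma_le_del.
Qed.

End Deletion.

(** * Dominating sets of the graph with the added path *)

Section PathAdditionTheory.
Variables (G : sgraph) (u v : G).
Implicit Types (D : {set G}) (b : bool).

Definition path3_set D b1 b2 b3 : {set path3 u v} :=
  [set a : path3 u v | match a with
                       | inl y => y \in D
                       | inr i => nth false [:: b1; b2; b3] i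
                       end].

Lemma path3_setE (A : {set path3 u v}) :
  exists D b1 b2 b3, A = path3_set D b1 b2 b3.
Proof.
(* Indices start at 0: [x 0], [x 1], [x 2] are $x_1$, $x_2$, $x_3$. *)
pose x i : path3 u v := inr (inord i).
exists [set y | (inl y : path3 u v) \in A], (x 0 \in A), (x 1 \in A), (x 2 \in A).
apply/setP => -[y | i]; rewrite !inE //.
rewrite -{1}(inord_val i).
by case: i => [[|[|[|//]]] ?].
Qed.

Lemma card_path3_set D b1 b2 b3 :
  #|path3_set D b1 b2 b3| = #|D| + (b1 + b2 + b3).
Proof.
rewrite -sum1_card big_sumType /= -(sum1_card (mem D)).
congr (_ + _); first by apply: eq_bigl => y; rewrite inE.
rewrite big_mkcond !big_ord_recr big_ord0 /= !inE /=.
by case: b1 b2 b3 => [] [] [].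
Qed.

(** The clauses express domination of the old vertices, $x_1$, $x_2$ and $x_3$, in this order. *)
Definition path3_spec D b1 b2 b3 :=
  [/\ forall y, [|| dominated D y, (y == u) && b1 | (y == v) && b3],
      [|| u \in D, b1 | b2], [|| b1, b2 | b3] & [|| b2, b3 | v \in D]].

Lemma path3_dominatingP D b1 b2 b3 :
  dominating (path3_set D b1 b2 b3) <-> path3_spec D b1 b2 b3.
Proof.
pose x i : path3 u v := inr (inord i).
have xE (i : nat) : i < 3 -> nat_of_ord (inord i : 'I_3) = i by move=> ?; rewrite inordK.
split.
  move/dominatingP => dom; split.
  (* The candidates are [y] itself, an old neighbour, $x_1$, $x_2$ and $x_3$; $x_2$ has no old
     neighbour. *)
  - move=> y; case/orP: (dom (inl y)) => [|/exists_inP[[z|[[|[|[|//]]] ?]]]].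
    + by rewrite inE => yD; rewrite dominated_in.
    + rewrite inE /= /path3_adj /= [adj z y]adj_sym orbb => zD yz.
      by apply/orP; left; apply/orP; right; apply/exists_inP; exists z.
    + by rewrite inE /= /path3_adj /= => ->; rewrite !andbT orbF => ->; rewrite orbT.
    + by rewrite /= /path3_adj /= andbF.
    + by rewrite inE /= /path3_adj /= => ->; rewrite andbF => /= ->; rewrite !orbT.
  - case/orP: (dom (x 0)) => [|/exists_inP[[z|[[|[|[|//]]] ?]]]];
      rewrite inE /= /path3_adj /= ?xE //= ?orbF.
    + by move->; rewrite orbT.
    + by rewrite andbT => zD /eqP <-; rewrite zD.
    + by move->; rewrite !orbT.
  - case/orP: (dom (x 1)) => [|/exists_inP[[z|[[|[|[|//]]] ?]]]];
      rewrite inE /= /path3_adj /= ?xE //= ?orbF ?andbF //.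
    + by move->; rewrite orbT.
    + by move->.
    + by move->; rewrite !orbT.
  - case/orP: (dom (x 2)) => [|/exists_inP[[z|[[|[|[|//]]] ?]]]];
      rewrite inE /= /path3_adj /= ?xE //= ?orbF ?andbF ?orbF //.
    + by move->; rewrite orbT.
    + by move=> zD /eqP <-; rewrite zD !orbT.
    + by move->.
case=> domD d1 d2 d3; apply/dominatingP.
have nb a c : c \in path3_set D b1 b2 b3 -> path3_adj u v a c ->
    dominated (path3_set D b1 b2 b3) a.
  by move=> cA ac; apply/orP; right; apply/exists_inP; exists c.
case=> [y | [[|[|[|//]]] lti]].
- case/or3P: (domD y) => [/orP[yD | /exists_inP[z zD yz]] | /andP[yu b1T] | /andP[yv b3T]].
  + by apply: dominated_in; rewrite inE.
  + by apply: (nb _ (inl z)); rewrite ?inE // /path3_adj /= yz.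
  + by apply: (nb _ (x 0)); rewrite ?inE /path3_adj /= ?xE // yu.
  + by apply: (nb _ (x 2)); rewrite ?inE /path3_adj /= ?xE // yv orbT.
- case/or3P: d1 => [uD | bT | bT].
  + by apply: (nb _ (inl u)); rewrite ?inE // /path3_adj /= eqxx.
  + by apply: dominated_in; rewrite inE.
  + by apply: (nb _ (x 1)); rewrite ?inE /path3_adj /= ?xE.
- case/or3P: d2 => bT.
  + by apply: (nb _ (x 0)); rewrite ?inE /path3_adj /= ?xE.
  + by apply: dominated_in; rewrite inE.
  + by apply: (nb _ (x 2)); rewrite ?inE /path3_adj /= ?xE.
- case/or3P: d3 => [bT | bT | vD].
  + by apply: (nb _ (x 1)); rewrite ?inE /path3_adj /= ?xE.
  + by apply: dominated_in; rewrite inE.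
  + by apply: (nb _ (inl v)); rewrite ?inE // /path3_adj /= eqxx.
Qed.

Lemma gamma_path3_le D b1 b2 b3 :
  path3_spec D b1 b2 b3 -> gamma (path3 u v) <= #|D| + (b1 + b2 + b3).
Proof. by move/path3_dominatingP/gamma_le; rewrite card_path3_set. Qed.

Lemma gamma_path3P : exists D b1 b2 b3,
  path3_spec D b1 b2 b3 /\ #|D| + (b1 + b2 + b3) = gamma (path3 u v).
Proof.
have [A domA <-] := gamma_setP (path3 u v).
have [D [b1 [b2 [b3 defA]]]] := path3_setE A.
exists D, b1, b2, b3; rewrite defA card_path3_set.
by split=> //; apply/path3_dominatingP; rewrite -defA.
Qed.

Lemma gamma_path3_leS : gamma (path3 u v) <= gamma G + 1.
Proof.
have [D /dominatingP domD <-] := gamma_setP G.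
(* Adding $x_2$ alone suffices, as it dominates all three new vertices. *)
by apply: (@gamma_path3_le D false true false); split; rewrite ?orbT // => y; rewrite domD.
Qed.

End PathAdditionTheory.

(** Reversing the path exchanges $x_1$ and $x_3$; this reduces (ii) to (i). *)
Lemma path3_spec_sym (G : sgraph) (u v : G) D b1 b2 b3 :
  path3_spec u v D b1 b2 b3 -> path3_spec v u D b3 b2 b1.
Proof.
case=> domD d1 d2 d3; split.
- by move=> y; rewrite [(y == v) && b3 || _]orbC.
- by case/or3P: d3 => ->; rewrite ?orbT.
- by case/or3P: d2 => ->; rewrite ?orbT.
- by case/or3P: d1 => ->; rewrite ?orbT.
Qed.

(** Bounds the cost of replacing a chosen new vertex by its old neighbour [x], which may already lie
    in [A]. *)
Lemma cardsU_if (T : finType) (b : bool) (x : T) (A : {set T}) :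
  #|(if b then [set x] else set0) :|: A| <= #|A| + b.
Proof.
case: b; last by rewrite set0U addn0.
by rewrite cardsU1 addnC leq_add2l; case: (_ \notin _).
Qed.

(** * Comparison of the two domination numbers *)

Section GammaPath3.
Variables (G : sgraph) (u v : G).

(** The bound omits [b2] because $x_2$ is dropped without replacement; this is the source of
    strictness when $x_2$ is chosen. *)
Lemma gamma_path3_spec D b1 b2 b3 :
  path3_spec u v D b1 b2 b3 -> gamma G <= #|D| + (b1 + b3).
Proof.
case=> domD _ _ _.
set E := (if b1 then [set u] else set0) :|: ((if b3 then [set v] else set0) :|: D).
have domE : dominating E.
  apply/dominatingP => y; case/or3P: (domD y) => [|/andP[/eqP-> bT]|/andP[/eqP-> bT]].
  - by apply: dominatedS; rewrite /E setUA subsetUr.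
  - by apply: dominated_in; rewrite /E bT !inE eqxx.
  - by apply: dominated_in; rewrite /E bT !inE eqxx !orbT.
apply: leq_trans (gamma_le domE) (leq_trans (cardsU_if _ _ _) _).
by rewrite [b1 + b3]addnC addnA leq_add2r cardsU_if.
Qed.

Lemma path3_spec_except D b3 : path3_spec u v D true false b3 ->
  #|D| + b3 < gamma G ->
  exists E : {set G}, [/\ v \in E, #|E| < gamma G & dominates_except u E].
Proof.
case=> domD _ _ vD ltD; exists ((if b3 then [set v] else set0) :|: D); split.
(* If neither $x_2$ nor $x_3$ is chosen, then $x_3$ must be dominated by [v]. *)
- by case: b3 vD {domD ltD} => /= vD; rewrite !inE ?eqxx ?vD.
- exact: leq_ltn_trans (cardsU_if _ _ _) ltD.
move=> y yNu; move: (domD y); rewrite (negPf yNu) /= => /orP[|/andP[/eqP-> ->]].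
  by apply: dominatedS; exact: subsetUr.
by apply: dominated_in; rewrite !inE eqxx.
Qed.

(** The added $x_1$ takes care of [u], itself and $x_2$, while [v] dominates $x_3$. *)
Lemma dominates_except_path3_spec (E : {set G}) :
  v \in E -> dominates_except u E -> path3_spec u v E true false false.
Proof.
move=> vE domE; split; rewrite ?vE ?orbT // => y.
by have [_ | /domE-> //] := eqVneq y u; rewrite orbT.
Qed.

End GammaPath3.

Theorem theorem17 (G : sgraph) (u v : G) (uNv : u != v) (nadj : ~~ adj u v) :
  (gamma G <= gamma (path3 u v) <= gamma G + 1) /\
  (gamma (path3 u v) = gamma G <->
     (u \in Vminus G /\ gamma_good (in_del (neq_sym uNv))) \/
     (v \in Vminus G /\ gamma_good (in_del uNv))).
Proof.
have ge_gamma : gamma G <= gamma (path3 u v).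
  have [D [b1 [b2 [b3 [/gamma_path3_spec leD <-]]]]] := gamma_path3P u v.
  by rewrite (leq_trans leD) // leq_add2l leq_add2r leq_addr.
split; first by rewrite ge_gamma gamma_path3_leS.
split=> [eq_gamma | ].
  have [D [b1 [b2 [b3 [spec]]]]] := gamma_path3P u v; rewrite eq_gamma => cardD.
  have b2F : b2 = false.
    (* Otherwise dropping $x_2$ would leave a bound on [gamma G] below [gamma G]. *)
    apply: contraTF (gamma_path3_spec spec) => b2T.
    by rewrite -cardD b2T -ltnNge ltn_add2l ltn_add2r addn1.
  rewrite {b2}b2F in spec cardD.
  have [b1T | b1F] := boolP b1.
    left; apply/Vminus_goodP; rewrite b1T in spec cardD; apply: (path3_spec_except spec).
    by rewrite -cardD addn0 ltn_add2l.
  (* With $x_1$ and $x_2$ not chosen, only $x_3$ can dominate $x_2$. *)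
  have b3T : b3 by case: spec; rewrite (negPf b1F).
  right; apply/Vminus_goodP; rewrite (negPf b1F) b3T in spec cardD.
  apply: (path3_spec_except (path3_spec_sym spec)).
  by rewrite -cardD ltn_add2l.
(* Since [E] has fewer than [gamma G] elements, there is room for one new vertex: $x_1$ in case (i),
   $x_3$ in case (ii). *)
case=> /Vminus_goodP[E [xE ltE domE]]; apply/eqP; rewrite eqn_leq ge_gamma andbT;
  apply: leq_trans (_ : #|E|.+1 <= _) => //; rewrite -addn1.
- exact: gamma_path3_le (dominates_except_path3_spec xE domE).
- exact: gamma_path3_le (path3_spec_sym (dominates_except_path3_spec xE domE)).
Qed.
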